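(* Assume the Axiom of Choice. Then: (1) every chain-complete poset is a complete meet-multisemilattice; (2) every dually chain-complete poset is a complete join-multisemilattice; (3) every doubly chain-complete poset is a complete multilattice.
   Context: Let $(P,\leq)$ be a poset. For $S\subseteq P$, $S^\ell=\{x\in P\mid\forall s\in S,\ x\leq s\}$ and $S^u=\{x\in P\mid\forall s\in S,\ s\leq x\}$ (so $\emptyset^\ell=\emptyset^u=P$); $\max(X)$ and $\min(X)$ denote the sets of maximal and minimal elements of $X$; $\downarrow X=\{y\in P\mid\exists x\in X,\ y\leq x\}$ and $\uparrow X=\{y\in P\mid\exists x\in X,\ x\leq y\}$. $S$ has all its multi-infima if $S^\ell=\downarrow\max(S^\ell)$, and all its multi-suprema if $S^u=\uparrow\min(S^u)$. $(P,\leq)$ is a complete meet-multisemilattice if every subset $S\subseteq P$ (including $\emptyset$) has all its multi-infima; a complete join-multisemilattice if every subset has all its multi-suprema; a complete multilattice if both. $(P,\leq)$ is chain-complete if every chain (including $\emptyset$) has a join (least upper bound); dually chain-complete if every chain (including $\emptyset$) has a meet; doubly chain-complete if both. *)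

(* Defs.v *)
From mathcomp Require Import all_boot all_order.
From mathcomp Require Import boolp classical_sets.

Set Implicit Arguments.
Unset Strict Implicit.
Unset Printing Implicit Defensive.

Local Open Scope classical_set_scope.
Local Open Scope order_scope.

Section Multilattice.
Context {d : Order.disp_t} {P : porderType d}.
Implicit Types S X C : set P.

(* S^ell and S^u are the library's [lbound S] and [ubound S], and the
   down-closure of X is its [down X]. *)

Definition up X : set P := [set y | exists x, X x /\ x <= y].

Definition maximals X : set P :=
  [set x | X x /\ forall y, X y -> x <= y -> y = x].

Definition minimals X : set P :=
  [set x | X x /\ forall y, X y -> y <= x -> y = x].

Definition has_multi_infima S : Prop := lbound S = down (maximals (lbound S)).

Definition has_multi_suprema S : Prop := ubound S = up (minimals (ubound S)).

Definition chain C : Prop := total_on C (fun x y => x <= y).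

End Multilattice.

Section Completeness.
Context {d : Order.disp_t} (P : porderType d).

Definition complete_meet_multisemilattice : Prop :=
  forall S : set P, has_multi_infima S.

Definition complete_join_multisemilattice : Prop :=
  forall S : set P, has_multi_suprema S.

Definition complete_multilattice : Prop :=
  complete_meet_multisemilattice /\ complete_join_multisemilattice.

(* [supremums C] is the set of least upper bounds of C, hence empty or a
   singleton; the empty chain is included, so P has a least element. *)
Definition chain_complete : Prop :=
  forall C : set P, chain C -> supremums C !=set0.

Definition dually_chain_complete : Prop :=
  forall C : set P, chain C -> infimums C !=set0.

Definition doubly_chain_complete : Prop :=
  chain_complete /\ dually_chain_complete.

End Completeness.

(* Main.v *)
(** For [x] in [S^ell], take a chain in [S^ell] above [x] and add [x] to it, so
    that its join is above [x] even if the chain was empty. The join lies in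
    [S^ell] again, because every [s] in [S] is an upper bound of the chain, so
    Zorn's lemma gives a maximal element of [S^ell] above [x]. The statement on
    multi-suprema is the same one in the dual order. *)
Require Import Defs.
From mathcomp Require Import all_boot all_order.
From mathcomp Require Import boolp classical_sets.

Import Order.Theory.
Local Open Scope classical_set_scope.
Local Open Scope order_scope.

Lemma chain_setU1 (d : Order.disp_t) (P : porderType d) (x : P) (C : set P) :
  lbound C x -> chain C -> chain (x |` C).
Proof.
move=> xC Cchain s t [->|Cs] [->|Ct]; first by left.
- by left; exact: xC.
- by right; exact: xC.
- exact: Cchain.
Qed.

(** Zorn's lemma runs on [T], the part of [X] above [x]: a maximal element of [T] is maximal in all
    of [X], since whatever lies above it is again above [x]. *)
Lemma maximal_above (d : Order.disp_t) (P : porderType d)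
    (X : set P) (x : P) :
  (forall C : set P, C `<=` X -> C !=set0 -> chain C ->
     exists2 y, X y & ubound C y) ->
  X x -> exists2 y, maximals X y & x <= y.
Proof.
move=> Xchain Xx; pose T := {y : P | X y /\ x <= y}.
pose x0 : T := exist _ x (conj Xx (lexx x)).
have [|r s t||[y [Xy xy]] ymax] :=
    @ZL_preorder T x0 (fun a b => sval a <= sval b).
- by move=> t; exact: lexx.
- exact: le_trans.
- move=> A Achain.
  have [|||y Xy yub] := Xchain (x |` (sval @` A)).
  + by move=> z [->|[[a [Xa ?]] _ <-]].
  + by exists x; left.
  + apply: chain_setU1 => [z [[a [? xa]] _ <-]|s t [a Aa <-] [b Ab <-]] //.
    exact: Achain.
  + have xy : x <= y by apply: yub; left.
    exists (exist _ y (conj Xy xy)) => a Aa.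
    by apply: yub; right; exists a.
(* Zorn's lemma for preorders only yields [z <= y] from [y <= z]; antisymmetry in [P] turns this
   into an equality. *)
- exists y => //; split=> // z Xz yz; apply/eqP; rewrite eq_le yz andbT.
  exact: (ymax (exist _ z (conj Xz (le_trans xy yz)))).
Qed.

Lemma chain_complete_meet (d : Order.disp_t) (P : porderType d) :
  chain_complete P -> complete_meet_multisemilattice P.
Proof.
move=> Pcc S; apply/seteqP; split=> [x Sx|x [y [[Sy _] xy]] s Ss]; last first.
  exact: le_trans xy (Sy s Ss).
have [C CS _ Cchain||y ymax xy] := @maximal_above _ _ (lbound S) x.
- have [y [yub ylub]] := Pcc C Cchain; exists y => // s Ss.
  by apply: ylub => c Cc; exact: CS.
- exact: Sx.
- by exists y.
Qed.

Lemma dually_chain_complete_join (d : Order.disp_t) (P : porderType d) :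
  dually_chain_complete P -> complete_join_multisemilattice P.
Proof.
(* In [P^d], suprema, lower bounds and maximal elements unfold to infima, upper bounds and minimal
   elements of [P]; only the two cases of comparability in a chain have to be exchanged. *)
move=> Pcc; apply: (@chain_complete_meet _ P^d) => C Cchain.
by apply: Pcc => s t Cs Ct; case: (Cchain s t Cs Ct); [right|left].
Qed.

Theorem theorem6p5 :
  (forall (d : Order.disp_t) (P : porderType d),
     chain_complete P -> complete_meet_multisemilattice P) /\
  (forall (d : Order.disp_t) (P : porderType d),
     dually_chain_complete P -> complete_join_multisemilattice P) /\
  (forall (d : Order.disp_t) (P : porderType d),
     doubly_chain_complete P -> complete_multilattice P).
Proof.
split; first exact: chain_complete_meet.
split; first exact: dually_chain_complete_join.
move=> d P [Pcc Pdcc]; split; first exact: chain_complete_meet.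
exact: dually_chain_complete_join.
Qed.
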